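(* Let $n\geq 2$, let $\Omega\subset\mathbb{R}^n$ be a bounded open set, and let $u\in C^2(\Omega)\cap C(\overline\Omega)$ be the solution of $$\Delta u=-1\ \text{in }\Omega,\qquad u=0\ \text{on }\partial\Omega.$$ Let $M=\max_{\overline\Omega}u$. If $u$ satisfies property (A) in $\Omega$, i.e. $\Omega$ is convex and the function $w(x)=\sqrt{M-u(x)}$ is convex in $\Omega$, then $\Omega$ is an ellipsoid and $u$ is the torsion function of that ellipsoid, namely, in suitable Cartesian coordinates, $\Omega=E=\{x:\sum_{i=1}^n a_i(x_i-\bar x_i)^2<R^2\}$ with $a_i>0$, $\sum_{i=1}^n a_i=n$, and $u(x)=u_E(x)=\frac{R^2-\sum_{i=1}^n a_i(x_i-\bar x_i)^2}{2n}$.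
   Context: The solution $u$ of $\Delta u=-1$ in $\Omega$, $u=0$ on $\partial\Omega$ is called the torsion function of $\Omega$. For a bounded convex open set $\Omega$, a function $v\in C(\overline\Omega)$ is said to satisfy property (A) in $\Omega$ if $\sqrt{M-v(x)}$ is convex in $\Omega$, where $M=\max_{\overline\Omega}v$. *)

(* Defs.v *)
From HB Require Import structures.
From mathcomp Require Import all_boot all_order all_algebra.
From mathcomp Require Import all_classical all_reals all_analysis.
Set Implicit Arguments. Unset Strict Implicit. Unset Printing Implicit Defensive.
Import Order.TTheory GRing.Theory Num.Theory.
Import numFieldNormedType.Exports.
Local Open Scope classical_set_scope.
Local Open Scope ring_scope.

Definition basis_vec (R : realType) (n : nat) (i : 'I_n) : 'rV[R]_n :=
  delta_mx 0 i.

Definition partial (R : realType) (n : nat) (i : 'I_n)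
  (f : 'rV[R]_n -> R) : 'rV[R]_n -> R :=
  fun x => 'D_(basis_vec R i) f x.

Definition C2_on (R : realType) (n : nat) (O : set 'rV[R]_n)
  (f : 'rV[R]_n -> R) : Prop :=
  (forall x, O x -> {for x, continuous f}) /\
  (forall i x, O x -> derivable f x (basis_vec R i)) /\
  (forall i x, O x -> {for x, continuous (partial i f)}) /\
  (forall i j x, O x -> derivable (partial i f) x (basis_vec R j)) /\
  (forall i j x, O x -> {for x, continuous (partial j (partial i f))}).

Definition laplacian (R : realType) (n : nat) (f : 'rV[R]_n -> R)
  (x : 'rV[R]_n) : R :=
  \sum_(i < n) partial i (partial i f) x.

Definition convex_set_in (R : realType) (n : nat) (O : set 'rV[R]_n) : Prop :=
  forall x y (t : R), O x -> O y -> 0 <= t <= 1 ->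
    O (t *: x + (1 - t) *: y).

Definition convex_fun_on (R : realType) (n : nat) (O : set 'rV[R]_n)
  (f : 'rV[R]_n -> R) : Prop :=
  forall x y (t : R), O x -> O y -> 0 <= t <= 1 ->
    f (t *: x + (1 - t) *: y) <= t * f x + (1 - t) * f y.

Definition is_max_on (R : realType) (n : nat) (K : set 'rV[R]_n)
  (v : 'rV[R]_n -> R) (M : R) : Prop :=
  (exists2 x, K x & v x = M) /\ (forall x, K x -> v x <= M).

Definition property_A (R : realType) (n : nat) (O : set 'rV[R]_n)
  (v : 'rV[R]_n -> R) : Prop :=
  convex_set_in O /\
  exists M : R, is_max_on (closure O) v M /\
    convex_fun_on O (fun x => Num.sqrt (M - v x)).

(* orthogonal matrix: a change of Cartesian coordinates (with a translation) *)
Definition orthogonal_mx (R : realType) (n : nat) (Q : 'M[R]_n) : Prop :=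
  Q *m Q^T = 1%:M.

Definition ell_form (R : realType) (n : nat) (Q : 'M[R]_n) (a : 'I_n -> R)
  (c x : 'rV[R]_n) : R :=
  \sum_(i < n) a i * (((x - c) *m Q) 0 i) ^+ 2.

(* Main.v *)
Require Import Defs.
From HB Require Import structures.
From mathcomp Require Import all_boot all_order all_algebra.
From mathcomp Require Import all_classical all_reals all_analysis.
From mathcomp Require Import ring lra.
Import Order.TTheory GRing.Theory Num.Theory.
Import numFieldNormedType.Exports.
Local Open Scope classical_set_scope.
Local Open Scope ring_scope.

(* Let c be a maximum point of u, v = M - u, and q(y) half the Hessian form of v
   at c, so that q has constant Laplacian 1. Convexity of sqrt v, which vanishes
   at c, gives v(c + t(x - c)) <= t^2 v(x); letting t tend to 0 yields
   v(x) >= q(x - c) on Omega. Hence v - q(. - c) is a nonnegative harmonic function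
   vanishing at c, and it vanishes identically by the strong maximum principle.
   So u = M - q(. - c) on the closure of Omega, and following each ray from c until
   it leaves Omega, where u = 0, identifies Omega with {q(. - c) < M} and shows that
   q is positive definite. Diagonalising q in an orthonormal basis finishes. *)

(** * Second derivative tests *)

(** Both difference quotients are the same function of the increment. This moves directional
    derivatives into one-variable calculus. *)
Lemma is_derive_line {R : realType} {V : normedModType R} (f : V -> R)
    (x v : V) (t d : R) :
  is_derive (t *: v + x) v f d <-> is_derive t 1 (fun s : R => f (s *: v + x)) d.
Proof.
have E : (fun h : R => h^-1 *: ((f \o shift (t *: v + x)) (h *: v) - f (t *: v + x))) =
   (fun h : R => h^-1 *: (((fun s : R => f (s *: v + x)) \o shift t) (h *: (1:R)) - f (t *: v + x))).
  by apply/funext => h /=; rewrite [h%:A]mulr1 scalerDl addrA.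
by split=> -[d1 d2]; split; move: d1 d2; rewrite /derivable /derive E.
Qed.

(** If [d < 0], then [f'] is negative just to the right of its zero at 0, and the mean value theorem
    makes [f] drop below [f 0]. A one-sided minimum is enough, which suits segments starting at the
    maximum point. *)
Lemma ge0_second_derive {R : realType} (f f' : R -> R) (d e : R) : 0 < e ->
  (forall t : R, `|t| < e -> is_derive t 1 f (f' t)) -> f' 0 = 0 ->
  is_derive (0 : R) 1 f' d -> (forall t, 0 <= t < e -> f 0 <= f t) -> 0 <= d.
Proof.
move=> e0 df f'0 df' fmin; rewrite leNgt; apply/negP => d0.
have [dv dd] := df'.
have : \forall h \near (0 : R)^', h^-1 *: ((f' \o shift 0) (h *: (1:R)) - f' 0) < 0.
  have cv : (fun h : R => h^-1 *: ((f' \o shift 0) (h *: (1:R)) - f' 0)) @ 0^' --> d.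
    by rewrite -dd.
  exact: (cvgr_lt _ cv).
rewrite /= near_withinE => -[s /= s0 Hs].
pose t := Num.min s e / 2.
have m0 : 0 < Num.min s e by rewrite lt_min s0 e0.
have t0 : 0 < t by rewrite divr_gt0.
have tm : t < Num.min s e by rewrite ltr_pdivrMr // ltr_pMr // ltr1n.
have := tm; rewrite lt_min => /andP[ts te].
have dft x : x \in `]0, t[%R -> is_derive x 1 f (f' x).
  move=> /[!in_itv] /= /andP[x0 xt]; apply: df.
  by rewrite gtr0_norm // (lt_trans xt).
have cf : {within `[0, t], continuous f}.
  apply: derivable_within_continuous => x /[!in_itv]/= /andP[x0 xt].
  have [] // : is_derive x 1 f (f' x).
  by apply: df; rewrite ger0_norm // (le_lt_trans xt).
have [c] := MVT t0 dft cf; rewrite in_itv /= => /andP[c0 ct] fE.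
have f'c : f' c < 0.
  have := Hs c; rewrite /= sub0r normrN gtr0_norm // => /(_ (lt_trans ct ts)) /(_ (lt0r_neq0 c0)).
  by rewrite f'0 subr0 addr0 [c%:A]mulr1 pmulr_rlt0 // invr_gt0.
have := fmin t; rewrite (ltW t0) te => /(_ isT).
by rewrite -subr_ge0 fE subr0 pmulr_lge0 // leNgt f'c.
Qed.

(** Derivatives are carried as explicit functions [D] and [DD], so that differences, multiples and
    barriers come with closed formulas. Only pure second derivatives are recorded, as these are what
    a Laplacian sums. *)
Definition twice_partial_on {R : realType} {n : nat} (O : set 'rV[R]_n)
    (f : 'rV[R]_n -> R) (D DD : 'I_n -> 'rV[R]_n -> R) :=
  forall i x, O x -> is_derive x (basis_vec R i) f (D i x) /\
                     is_derive x (basis_vec R i) (D i) (DD i x).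

Lemma twice_partial_onB {R : realType} {n : nat} (O : set 'rV[R]_n) f D DD g E EE :
  twice_partial_on O f D DD -> twice_partial_on O g E EE ->
  twice_partial_on O (fun x => f x - g x) (fun i x => D i x - E i x)
    (fun i x => DD i x - EE i x).
Proof.
by move=> df dg i x Ox; have [? ?] := df i x Ox; have [? ?] := dg i x Ox;
  split; exact: is_deriveB.
Qed.

Lemma twice_partial_onZ {R : realType} {n : nat} (O : set 'rV[R]_n) (k : R) f D DD :
  twice_partial_on O f D DD ->
  twice_partial_on O (fun x => k * f x) (fun i x => k * D i x)
    (fun i x => k * DD i x).
Proof.
by move=> df i x Ox; have [? ?] := df i x Ox; split; exact: is_deriveZ.
Qed.

Lemma line_near {R : realType} {n : nat} (O : set 'rV[R]_n) (x v : 'rV[R]_n) :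
  nbhs x O -> exists2 e : R, 0 < e & forall t, `|t| < e -> O (t *: v + x).
Proof.
move=> Ox.
have c : (fun t : R => t *: v + x) @ (0 : R) --> x.
  have -> : x = 0 *: v + x by rewrite scale0r add0r.
  rewrite {1}scale0r add0r; apply: cvgD; last exact: cvg_cst.
  exact: scalel_continuous.
have /nbhs_ballP[e /= e0 He] := c _ Ox.
by exists e => // t te; apply: He; rewrite /ball /= sub0r normrN.
Qed.

Lemma second_partial_min {R : realType} {n : nat} (O : set 'rV[R]_n) f D DD x :
  twice_partial_on O f D DD -> nbhs x O ->
  (\forall y \near x, f x <= f y) -> forall i, D i x = 0 /\ 0 <= DD i x.
Proof.
move=> df Ox fx i.
have [e e0 He] : exists2 e : R, 0 < e & forall t, `|t| < e ->
    (O `&` [set y | f x <= f y]) (t *: basis_vec R i + x).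
  by apply: line_near; exact: filterI.
pose g t := f (t *: basis_vec R i + x).
have dg (t : R) : `|t| < e -> is_derive t 1 g (D i (t *: basis_vec R i + x)).
  by move=> /He[Ot _]; exact: (is_derive_line f x (basis_vec R i) t _).1 (df i _ Ot).1.
have gx : g 0 = f x by rewrite /g scale0r add0r.
have D0 : D i x = 0.
  have [||||d1 d2] := @derive1_at_min R g (- e) e 0.
  - by rewrite ge0_cp // ltW.
  - move=> t /[!in_itv] /= te; have [] // := dg t.
    by rewrite ltr_norml.
  - by rewrite in_itv /= oppr_lt0 e0.
  - move=> t /[!in_itv] /= te; rewrite gx.
    have [] // := He t; by rewrite ltr_norml.
  - have [|_ ] := dg 0; first by rewrite normr0.
    by rewrite d2 scale0r add0r.
split=> //.
apply: (@ge0_second_derive R g (fun t => D i (t *: basis_vec R i + x)) _ e) => //.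
- by rewrite scale0r add0r.
- apply: (is_derive_line (D i) x (basis_vec R i) 0 _).1; rewrite scale0r add0r.
  by have [] := df i x (nbhs_singleton Ox).
- move=> t /andP[t0 te]; rewrite gx; have [] // := He t.
  by rewrite ger0_norm.
Qed.

(** * Directional derivatives from continuous partial derivatives *)

(** Stating the mean value theorem with absolute values covers increments of either sign, and
    [a = 0], at once. *)
Lemma MVT_origin {R : realType} (g g' : R -> R) (a : R) :
  (forall s : R, `|s| <= `|a| -> is_derive s 1 g (g' s)) ->
  exists2 c, `|c| <= `|a| & g a - g 0 = a * g' c.
Proof.
move=> dg.
have dv (s : R) : `|s| <= `|a| -> derivable g s 1 by case/dg.
have [a0|a0] := leP 0 a.
  have [||c] := @MVT_segment R g g' 0 a a0.
  - move=> s /[!in_itv]/= /andP[s0 sa]; apply: dg.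
    by rewrite !ger0_norm // ltW.
  - apply: derivable_within_continuous => s /[!in_itv]/= /andP[s0 sa].
    by apply: dv; rewrite !ger0_norm.
  rewrite in_itv /= => /andP[c0 ca] e; exists c; first by rewrite !ger0_norm.
  by rewrite e subr0 mulrC.
have [||c] := @MVT_segment R g g' a 0 (ltW a0).
- move=> s /[!in_itv]/= /andP[s0 sa]; apply: dg.
  by rewrite !ltr0_norm // lerN2 ltW.
- apply: derivable_within_continuous => s /[!in_itv]/= /andP[s0 sa].
  by apply: dv; rewrite (ltr0_norm a0) ler0_norm // lerN2.
rewrite in_itv /= => /andP[c0 ca] e; exists c.
  by rewrite (ltr0_norm a0) ler0_norm // lerN2.
by rewrite -opprB e sub0r mulrN opprK mulrC.
Qed.

(** The increment along [v] is telescoped into moves along one coordinate at a time. The mean value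
    theorem turns each move into a value of [D i] near [x], and continuity of [D i] gives the
    limit. *)
Lemma is_derive_continuous_partials {R : realType} {n : nat} (f : 'rV[R]_n -> R)
    (D : 'I_n -> 'rV[R]_n -> R) (x v : 'rV[R]_n) :
  (\forall y \near x, forall i, is_derive y (basis_vec R i) f (D i y)) ->
  (forall i, {for x, continuous (D i)}) ->
  is_derive x v f (\sum_(i < n) v 0 i * D i x).
Proof.
move=> df Dc.
pose L w := fun h : R => h^-1 * (f (h *: w + x) - f x).
(* One coordinate move of length [h * c], started from the point [h *: w + x] that itself depends on
   [h]. *)
have step i (w : 'rV[R]_n) (c : R) :
    (fun h : R => h^-1 * (f ((h * c) *: basis_vec R i + (h *: w + x))
       - f (h *: w + x))) @ 0^' --> c * D i x.
  apply/cvgrPdist_le => /= e e0.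
  have e1 : 0 < e / (`|c| + 1) by rewrite divr_gt0 // ltr_wpDl.
  have : \forall y \near x, (forall i, is_derive y (basis_vec R i) f (D i y)) /\
      `|D i x - D i y| < e / (`|c| + 1).
    apply: filterI => //; move/cvgrPdist_lt: (Dc i) => /(_ _ e1).
    exact.
  move=> /nbhs_ballP[r /= r0 Hr].
  (* The bound [|h| * B < r] keeps the whole coordinate segment inside the ball of radius [r] about
     [x]. *)
  pose B := `|w| + `|c| * `|basis_vec R i| + 1.
  have B0 : 0 < B by rewrite ltr_wpDl // addr_ge0 // mulr_ge0.
  rewrite near_withinE; apply/nbhs_ballP; exists (r / B); first exact: divr_gt0.
  move=> h /=; rewrite /ball /= sub0r normrN ltr_pdivlMr // => hB hn0.
  have inb s : `|s| <= `|h * c| -> ball x r (s *: basis_vec R i + (h *: w + x)).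
    rewrite normrM => sh; rewrite -ball_normE /ball_ /=.
    rewrite addrA opprD addrCA subrr addr0 normrN.
    apply: (le_lt_trans (ler_normD _ _)); rewrite !normrZ.
    apply: le_lt_trans hB; rewrite /B mulrDr mulr1 mulrDr -addrA [leLHS]addrC.
    by rewrite lerD2l ler_wpDr // mulrA ler_wpM2r.
  have [s sh E] := @MVT_origin R (fun s => f (s *: basis_vec R i + (h *: w + x)))
    (fun s => D i (s *: basis_vec R i + (h *: w + x))) (h * c)
    (fun s sh => (is_derive_line _ _ _ _ _).1 ((Hr _ (inb s sh)).1 i)).
  move: E; rewrite /= scale0r add0r => ->.
  rewrite -[h * c * _]mulrA mulKf // -mulrBr normrM.
  have [_ Ds] := Hr _ (inb s sh).
  apply: (le_trans (ler_wpM2l (normr_ge0 c) (ltW Ds))).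
  by rewrite mulrCA ler_piMr ?(ltW e0) // ler_pdivrMr ?ltr_wpDl // mul1r ler_wpDr.
have cvL : forall r : seq 'I_n,
    L (\sum_(i <- r) v 0 i *: basis_vec R i) @ 0^' --> \sum_(i <- r) v 0 i * D i x.
  elim=> [|i r IH].
    rewrite !big_nil (_ : L 0 = cst 0); first exact: cvg_cst.
    by apply/funext => h; rewrite /L scaler0 add0r subrr mulr0.
  rewrite !big_cons; set w := \sum_(j <- r) _ in IH *.
  have -> : L (v 0 i *: basis_vec R i + w) = (fun h : R =>
      h^-1 * (f ((h * v 0 i) *: basis_vec R i + (h *: w + x)) - f (h *: w + x))) \+ L w.
    apply/funext => h; rewrite /L /= -mulrDr addrA subrK scalerDr scalerA.
    by rewrite addrA.
  exact: (cvgD (step i w (v 0 i)) IH).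
have vE : \sum_(i < n) v 0 i *: basis_vec R i = v.
  by rewrite [RHS]row_sum_delta.
have := cvL (index_enum 'I_n); rewrite vE => cv.
split; first by apply/cvg_ex; eexists; exact: cv.
exact: (cvg_lim _ cv).
Qed.

(** * Bilinear forms on row vectors *)

(** The norm on row vectors is the maximum norm, so [bform 1%:M x x] serves as the squared Euclidean
    norm. *)
Definition bform {R : realType} {n : nat} (S : 'M[R]_n) (x y : 'rV[R]_n) : R :=
  (x *m S *m y^T) 0 0.

Section BilinearForm.
Context {R : realType} {n : nat}.
Implicit Types (S : 'M[R]_n) (x y z : 'rV[R]_n).

Lemma bformDl S x y z : bform S (x + y) z = bform S x z + bform S y z.
Proof. by rewrite /bform !mulmxDl mxE. Qed.

Lemma bformDr S x y z : bform S z (x + y) = bform S z x + bform S z y.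
Proof. by rewrite /bform linearD mulmxDr mxE. Qed.

Lemma bformZl S (k : R) x y : bform S (k *: x) y = k * bform S x y.
Proof. by rewrite /bform -!scalemxAl mxE. Qed.

Lemma bformZr S (k : R) x y : bform S x (k *: y) = k * bform S x y.
Proof. by rewrite /bform linearZ -scalemxAr mxE. Qed.

Lemma bformC S x y : S^T = S -> bform S x y = bform S y x.
Proof.
move=> sS; rewrite /bform; have -> : (x *m S *m y^T) 0 0 = (x *m S *m y^T)^T 0 0.
  by rewrite [RHS]mxE.
by rewrite !trmx_mul trmxK sS mulmxA.
Qed.

Lemma bformE S x y : bform S x y = \sum_i \sum_j S i j * (x 0 i * y 0 j).
Proof.
rewrite /bform mxE exchange_big; apply: eq_bigr => j _; rewrite !mxE mulr_suml.
by apply: eq_bigr => i _; rewrite mulrAC mulrA [S i j * _]mulrC mulrAC.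
Qed.

Lemma bform_basis S i x : bform S (basis_vec R i) x = \sum_j S i j * x 0 j.
Proof.
rewrite bformE (bigD1 i) //= [X in _ + X]big1 ?addr0.
  by apply: eq_bigr => j _; rewrite mxE !eqxx mul1r.
by move=> k /negPf ki; rewrite big1 // => j _; rewrite mxE ki andbF mul0r mulr0.
Qed.

Lemma bform1E x y : bform 1%:M x y = \sum_i x 0 i * y 0 i.
Proof. by rewrite /bform mulmx1 mxE; apply: eq_bigr => i _; rewrite mxE. Qed.

Lemma continuous_bform S c : continuous (fun x => bform S (x - c) (x - c)).
Proof.
have cc i : continuous (fun x : 'rV[R]_n => (x - c) 0 i).
  move=> x; rewrite (_ : (fun _ => _) = (fun x : 'rV[R]_n => x 0 i - c 0 i)).
    apply: continuousB; first exact: coord_continuous.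
    exact: cst_continuous.
  by apply/funext => y; rewrite !mxE.
have cij i j : continuous (fun x : 'rV[R]_n => S i j * ((x - c) 0 i * (x - c) 0 j)).
  move=> x; have := cvgMl_tmp (a := S i j) (cvgM (cc i x) (cc j x)).
  exact.
rewrite (_ : (fun _ => _) =
   (fun x => \sum_i \sum_j S i j * ((x - c) 0 i * (x - c) 0 j))); last first.
  by apply/funext => y; rewrite bformE.
apply: continuous_big => [|i _]; first exact: add_continuous.
apply: continuous_big => [|j _]; first exact: add_continuous.
exact: cij.
Qed.

(** Along the line the difference quotient is exactly [d + h * k], so all polynomial derivatives
    below reduce to ring identities. *)
Lemma is_derive_quadratic {V : normedModType R} (f : V -> R) (x v : V) (d k : R) :
  (forall h : R, f (h *: v + x) = f x + h * d + h ^+ 2 * k) -> is_derive x v f d.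
Proof.
move=> fE.
have cv : (fun h : R => h^-1 *: ((f \o shift x) (h *: v) - f x)) @ 0^' --> d.
  have c : (fun h : R => d + h * k) @ 0^' --> d + 0 * k.
    apply: cvg_within_filter; apply: cvgD; first exact: cvg_cst.
    have id0 : (fun h : R => h) @ (0 : R) --> (0 : R) by exact: cvg_id.
    have := cvgMr_tmp (b := k) id0.
    exact.
  rewrite mul0r addr0 in c; apply: cvg_trans c; apply: near_eq_cvg.
  rewrite near_withinE; near=> h => h0 /=.
  rewrite fE [X in _ *: X]addrC addrA addKr; rewrite /GRing.scale /=.
  by rewrite expr2 -mulrA -mulrDr mulKf.
by split; [apply/cvg_ex; exists d | exact: cvg_lim cv].
Unshelve. all: by end_near. Qed.

Lemma is_derive_bform S c x v : S^T = S ->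
  is_derive x v (fun x => bform S (x - c) (x - c)) (2 * bform S v (x - c)).
Proof.
move=> sS; apply: (@is_derive_quadratic _ _ _ _ _ (bform S v v)) => h.
rewrite -addrA; move: (x - c) => y.
rewrite !(bformDl, bformDr, bformZl, bformZr) (bformC S y v) //.
by ring.
Qed.

Lemma is_derive_bforml S c x v y :
  is_derive x v (fun x => bform S y (x - c)) (bform S y v).
Proof.
apply: (@is_derive_quadratic _ _ _ _ _ 0) => h.
by rewrite -addrA; move: (x - c) => z; rewrite bformDr bformZr; ring.
Qed.

Lemma twice_partial_on_bform (O : set 'rV[R]_n) S c : S^T = S ->
  twice_partial_on O (fun x => bform S (x - c) (x - c))
    (fun i x => 2 * bform S (basis_vec R i) (x - c)) (fun i x => 2 * S i i).
Proof.
move=> sS i x _; split; first exact: is_derive_bform.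
have -> : S i i = bform S (basis_vec R i) (basis_vec R i).
  rewrite bform_basis (bigD1 i) //= big1 ?addr0 ?mxE ?eqxx ?mulr1 //.
  by move=> j /negPf ji; rewrite mxE ji andbF mulr0.
exact: is_deriveZ (is_derive_bforml S c x _ _).
Qed.

(** The maximum norm is attained at some coordinate, whose square is one term of the Euclidean sum.
    Euclidean smallness thus implies topological closeness. *)
Lemma sqr_norm_le x : `|x| ^+ 2 <= bform 1%:M x x.
Proof.
rewrite bform1E; have [->|x0] := eqVneq x 0.
  by rewrite normr0 expr0n; apply: sumr_ge0 => i _; rewrite mxE mulr0.
have nx0 : `|x| != 0 by rewrite normr_eq0.
have [[k i] /= xE] := mx_norm_neq0 nx0; rewrite (xE : `|x| = _) (ord1 k).
rewrite (bigD1 i) //= real_normK ?num_real // expr2 lerDl.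
by apply: sumr_ge0 => j _; rewrite -expr2 sqr_ge0.
Qed.

Lemma bform1_ge0 x : 0 <= bform 1%:M x x.
Proof. exact: le_trans (sqr_ge0 _) (sqr_norm_le x). Qed.

Lemma bform1_eq0 x : (bform 1%:M x x == 0) = (x == 0).
Proof.
apply/idP/eqP => [/eqP b0|->]; last by rewrite bform1E big1 // => i _; rewrite mxE mulr0.
by have := sqr_norm_le x; rewrite b0 => /(conj (sqr_ge0 `|x|)) /andP /le_anti /esym /eqP;
  rewrite sqrf_eq0 normr_eq0 => /eqP.
Qed.

End BilinearForm.

(** * The strong maximum principle *)

Section Barrier.
Context {R : realType} {n : nat}.
Implicit Types (x y z p v : 'rV[R]_n).

Lemma is_derive_expR_comp (g : 'rV[R]_n -> R) x v (d : R) :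
  is_derive x v g d -> is_derive x v (fun y => expR (g y)) (expR (g x) * d).
Proof.
move=> dg; have xE : x = 0 *: v + x by rewrite scale0r add0r.
rewrite [X in is_derive X](xE); apply/(is_derive_line (fun y => expR (g y)) x v 0).
apply: (@is_derive1_comp R expR (fun s : R => g (s *: v + x))).
  by rewrite -xE; exact: is_derive_expR.
by apply/(is_derive_line g x v 0); rewrite -xE.
Qed.

(** The Gaussian barrier of Hopf, centred at [p]. *)
Definition barrier (a : R) p x : R := expR (- a * bform 1%:M (x - p) (x - p)).

Lemma is_derive_barrier a p x v :
  is_derive x v (barrier a p) (- (2 * a) * (bform 1%:M v (x - p) * barrier a p x)).
Proof.
have d1 := is_deriveZ (- a) (is_derive_bform 1%:M p x v (trmx1 _ _)).
apply: (is_derive_eq (is_derive_expR_comp _ _ _ _ d1)).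
rewrite /barrier /GRing.scale /=; ring.
Qed.

Lemma twice_partial_on_barrier (O : set 'rV[R]_n) a p :
  twice_partial_on O (barrier a p)
    (fun i x => - (2 * a) * (bform 1%:M (basis_vec R i) (x - p) * barrier a p x))
    (fun i x => (4 * a ^+ 2 * (x - p) 0 i ^+ 2 - 2 * a) * barrier a p x).
Proof.
move=> i x _; split; first exact: is_derive_barrier.
have d1 := is_deriveM (is_derive_bforml 1%:M p x (basis_vec R i) (basis_vec R i))
  (is_derive_barrier a p x (basis_vec R i)).
have bE y : bform 1%:M (basis_vec R i) y = y 0 i.
  rewrite bform_basis (bigD1 i) //= big1 ?addr0 ?mxE ?eqxx ?mul1r //.
  by move=> j /negPf ji; rewrite mxE eq_sym ji mul0r.
apply: (is_derive_eq (is_deriveZ (- (2 * a)) d1)).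
rewrite !bE [basis_vec R i 0 i]mxE !eqxx /GRing.scale /=; ring.
Qed.

(** This is the Laplacian of the barrier; it is positive wherever [2 * a * |x - p|^2 > n] in the
    Euclidean norm, for [a > 0]. *)
Lemma sum_second_partial_barrier a p x :
  \sum_(i < n) (4 * a ^+ 2 * (x - p) 0 i ^+ 2 - 2 * a) * barrier a p x =
  2 * a * (2 * a * bform 1%:M (x - p) (x - p) - n%:R) * barrier a p x.
Proof.
rewrite -mulr_suml; congr (_ * _); rewrite sumrB sumr_const card_ord -mulr_sumr.
rewrite bform1E; under [in RHS]eq_bigr do rewrite -expr2.
rewrite -mulr_natl; ring.
Qed.

Lemma continuous_barrier a p : continuous (barrier a p).
Proof.
move=> x; apply: (@continuous_comp _ _ _
  (fun x => - a * bform 1%:M (x - p) (x - p)) expR); last exact: continuous_expR.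
have := cvgMl_tmp (a := - a) (continuous_bform 1%:M p x).
exact.
Qed.

Lemma bounded_bform1 p (r : R) : bounded_set [set x | bform 1%:M (x - p) (x - p) <= r].
Proof.
exists (`|p| + `|r| + 1); split; first exact: num_real.
move=> M Mr x /= xr; apply: le_trans (ltW Mr).
have : `|x - p| ^+ 2 <= (`|r| + 1) ^+ 2.
  apply: le_trans (sqr_norm_le _) _; apply: le_trans xr _.
  apply: le_trans (ler_norm r) _; have := normr_ge0 r; nra.
rewrite ler_sqr ?nnegrE ?addr_ge0 // => xp.
have -> : x = p + (x - p) by rewrite addrC subrK.
by apply: le_trans (ler_normD _ _) _; rewrite -addrA lerD2l.
Qed.

(* Comparison on the annulus [rho <= |x - p|^2 <= r] with the subharmonic
   barrier [exp (- a |x - p|^2)], [a] large: positivity at the centre spreads to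
   the whole ball. *)
Lemma superharmonic_pos_ball (O : set 'rV[R]_n) h D DD p z (r : R) :
  twice_partial_on O h D DD -> (forall x, O x -> \sum_(i < n) DD i x <= 0) ->
  (forall x, O x -> {for x, continuous h}) -> (forall x, O x -> 0 <= h x) ->
  (forall x, bform 1%:M (x - p) (x - p) <= r -> O x) ->
  0 < h p -> bform 1%:M (z - p) (z - p) < r -> 0 < h z.
Proof.
move=> dh lap hc h0 rO hp zr.
set N := fun x => bform 1%:M (x - p) (x - p).
have cN : continuous N by exact: continuous_bform.
have Op : O p.
  apply: rO; rewrite subrr; apply: le_trans (ltW zr).
  by rewrite {1}/bform mul0mx mul0mx mxE bform1_ge0.
pose e := h p / 2.
have e0 : 0 < e by rewrite divr_gt0.
(* [s] is the squared inner radius: by continuity [h] exceeds half its central value there. *)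
have [s s0 Hs] : exists2 s : R, 0 < s & forall x, N x <= s -> e < h x.
  have : \forall x \near p, e < h x.
    by apply: (cvgr_gt _ (hc p Op)); rewrite /e ltr_pdivrMr // ltr_pMr // ltr1n.
  move=> /nbhs_ballP[d /= d0 Hd]; exists ((d / 2) ^+ 2); first by rewrite exprn_gt0 // divr_gt0.
  move=> x Nx; apply: Hd; rewrite -ball_normE /ball_ /= distrC.
  have : `|x - p| ^+ 2 <= (d / 2) ^+ 2 by exact: le_trans (sqr_norm_le _) Nx.
  rewrite ler_sqr ?nnegrE // ?divr_ge0 // ?(ltW d0) // => /le_lt_trans; apply.
  by rewrite ltr_pdivrMr // ltr_pMr // ltr1n.
have [Nzs|sNz] := leP (N z) s; first exact: lt_trans e0 (Hs _ Nzs).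
(* This gives [2 * a * s = 2 * (n + 1) > n], so the barrier is strictly subharmonic on the
   annulus. *)
pose a := n.+1%:R / s.
have a0 : 0 < a by rewrite divr_gt0.
pose b := barrier a p; pose br := expR (- a * r).
pose K := [set x | s <= N x] `&` [set x | N x <= r].
have cK : compact K.
  apply: bounded_closed_compact.
    have [M [Mr HM]] := bounded_bform1 p r.
    by exists M; split => // m mM x [_ xr]; exact: HM.
  apply: closedI; first exact: (closed_comp (fun x _ => cN x) (@closed_ge _ s)).
  exact: (closed_comp (fun x _ => cN x) (@closed_le _ r)).
pose g := fun x => h x - e * b x.
have cg : {within K, continuous g}.
  apply/continuous_in_subspaceT => x /[!inE] -[_ xr].
  have cb : {for x, continuous (fun x => e * b x)}.
    by have := cvgMl_tmp (a := e) (continuous_barrier a p x); exact.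
  exact: (cvgB (hc x (rO x xr)) cb).
have K0 : K !=set0 by exists z; split; rewrite /= ltW.
have [y /[!inE] -[/= sy yr] ymin] := EVT_min_rV K0 cK cg.
(* This bound gives [h z >= e * (b z - br)], which is positive because [N z < r]. *)
suff gy : - (e * br) <= g y.
  have Kz : z \in K by rewrite inE; split; rewrite /= ltW.
  have := le_trans gy (ymin z Kz).
  rewrite /g lerBrDl -mulrBr; apply: lt_le_trans; rewrite mulr_gt0 // subr_gt0.
  by rewrite ltr_expR // !mulNr ltrN2 ltr_pM2l.
rewrite leNgt; apply/negP => gy.
(* A minimum below [- (e * br)] cannot lie on the inner sphere, where [h > e] and [b <= 1], nor on
   the outer one, where [h >= 0] and [b = br]. *)
have {}sy : s < N y.
  rewrite ltNge; apply/negP => /Hs hy; move: gy; apply/negP; rewrite -leNgt.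
  rewrite /g lerBrDl -mulrBr; apply: le_trans (ltW hy).
  rewrite ger_pMr // lerBlDr; apply: (@le_trans _ _ 1); last by rewrite lerDl expR_ge0.
  by rewrite -expR0 ler_expR mulNr oppr_le0 mulr_ge0 ?bform1_ge0 // ltW.
have {}yr' : N y < r.
  rewrite lt_neqAle yr andbT; apply/eqP => Nyr; move: gy; apply/negP; rewrite -leNgt.
  by rewrite /g lerBrDl /b /barrier -/(N y) Nyr subrr h0 //; exact: rO.
have Ky : \forall x \near y, K x.
  apply: filterI.
    by near=> x; apply: ltW; near: x; exact: (cvgr_gt _ (cN y)).
  by near=> x; apply: ltW; near: x; exact: (cvgr_lt _ (cN y)).
have dhK : twice_partial_on K h D DD by move=> i x [_ /rO Ox]; exact: dh.
have dg := twice_partial_onB _ _ _ _ _ _ _ dhK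
  (twice_partial_onZ _ e _ _ _ (twice_partial_on_barrier K a p)).
have gmin : \forall x \near y, g y <= g x.
  by apply: filterS Ky => x Kx; apply: ymin; rewrite inE.
(* An interior minimum of [g] has nonnegative Laplacian, whereas [h] is superharmonic and [e * b]
   strictly subharmonic. *)
have : 0 <= \sum_(i < n) (DD i y - e * ((4 * a ^+ 2 * (y - p) 0 i ^+ 2 - 2 * a) * barrier a p y)).
  by apply: sumr_ge0 => i _; have [] := second_partial_min _ _ _ _ _ dg Ky gmin i.
rewrite sumrB -mulr_sumr sum_second_partial_barrier subr_ge0 leNgt => /negP; apply.
apply: le_lt_trans (lap y (rO y yr)) _.
apply: mulr_gt0; first exact: e0.
apply: mulr_gt0; last by rewrite /barrier expR_gt0.
apply: mulr_gt0; first exact: mulr_gt0.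
rewrite subr_gt0.
apply: (@lt_le_trans _ _ (2 * a * s)).
  by rewrite /a -mulrA divfK ?gt_eqF // -natrM ltr_nat mul2n -addnn ltn_addr.
by rewrite ler_pM2l; [exact: ltW | exact: mulr_gt0].
Unshelve. all: by end_near. Qed.

End Barrier.

(** The segment from [c] to [p] is covered by balls of one fixed radius [d], all inside [O] by
    convexity, and the zero of [h] is passed from each centre to the next. *)
Lemma superharmonic_strong_min {R : realType} {n : nat} (O : set 'rV[R]_n)
    h D DD (c p : 'rV[R]_n) :
  open O -> convex_set_in O ->
  twice_partial_on O h D DD -> (forall x, O x -> \sum_(i < n) DD i x <= 0) ->
  (forall x, O x -> {for x, continuous h}) -> (forall x, O x -> 0 <= h x) ->
  O c -> h c = 0 -> O p -> h p = 0.
Proof.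
move=> oO cO dh lap hc h0 Oc hc0 Op.
have ballO x : O x -> exists2 d : R, 0 < d & forall y, `|y| < d -> O (x + y).
  move=> /oO /nbhs_ballP[d /= d0 Hd]; exists d => // y yd; apply: Hd.
  by rewrite -ball_normE /ball_ /= opprD addNKr normrN.
have [d1 d10 H1] := ballO c Oc; have [d2 d20 H2] := ballO p Op.
pose d := Num.min d1 d2 / 2.
have m0 : 0 < Num.min d1 d2 by rewrite lt_min d10 d20.
have d0 : 0 < d by rewrite divr_gt0.
have : d < Num.min d1 d2 by rewrite ltr_pdivrMr // ltr_pMr // ltr1n.
rewrite lt_min => /andP[dd1 dd2].
pose q t := t *: p + (1 - t) *: c.
have qO (t : R) x : 0 <= t <= 1 -> bform 1%:M (x - q t) (x - q t) <= d ^+ 2 -> O x.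
  move=> t01 /(le_trans (sqr_norm_le _)).
  rewrite ler_sqr ?nnegrE ?(ltW d0) // => xd.
  (* A point near [q t] is the same convex combination of [p] and [c], both shifted by the same
     small vector. *)
  have -> : x = t *: (p + (x - q t)) + (1 - t) *: (c + (x - q t)).
    by apply/rowP => j; rewrite /q !mxE; ring.
  by apply: cO => //; [apply: H2 | apply: H1]; exact: le_lt_trans xd _.
pose B := bform 1%:M (p - c) (p - c).
(* With [m > B / d^2] and [m >= 1], the squared step length [B / m^2] is below [d^2]. *)
have [m mB] : exists m : nat, B / d ^+ 2 < m%:R.
  exists (Num.bound (B / d ^+ 2)); apply: archi_boundP.
  by rewrite divr_ge0 ?bform1_ge0 ?sqr_ge0.
have m_gt0 : 0 < m%:R :> R.
  by apply: le_lt_trans mB; rewrite divr_ge0 ?bform1_ge0 ?sqr_ge0.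
have mB' : B < m%:R * d ^+ 2 by rewrite -ltr_pdivrMr ?exprn_gt0.
have E s t : q s - q t = (s - t) *: (p - c).
  by rewrite /q; apply/rowP => i; rewrite !mxE; ring.
have step k : (k <= m)%N -> h (q (k%:R / m%:R)) = 0.
  elim: k => [_|k IH km]; first by rewrite mul0r /q scale0r subr0 scale1r add0r.
  have kt : 0 <= (k.+1%:R / m%:R : R) <= 1.
    by rewrite divr_ge0 //= ler_pdivrMr // mul1r ler_nat.
  have Oq : O (q (k.+1%:R / m%:R)).
    by apply: (qO _ _ kt); rewrite subrr {1}/bform mul0mx mul0mx mxE sqr_ge0.
  apply/eqP; rewrite eq_le h0 // andbT leNgt; apply/negP => hq.
  (* Positivity at the next centre would spread to the previous one, where [h] is 0 by induction. *)
  suff Nq : bform 1%:M (q (k%:R / m%:R) - q (k.+1%:R / m%:R))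
      (q (k%:R / m%:R) - q (k.+1%:R / m%:R)) < d ^+ 2.
    have := @superharmonic_pos_ball R n O h D DD _ _ (d ^+ 2)
      dh lap hc h0 (fun x => qO _ x kt) hq Nq.
    by rewrite IH ?ltxx // ltnW.
  have kE : k%:R / m%:R - k.+1%:R / m%:R = - m%:R^-1 :> R.
    by rewrite -mulrBl -natr1 opprD addrA subrr sub0r mulN1r.
  rewrite E bformZl bformZr -/B kE mulrA mulrNN -invfM mulrC ltr_pdivrMr ?mulr_gt0 //.
  apply: lt_le_trans mB' _; rewrite mulrC ler_pM2l ?exprn_gt0 //.
  by rewrite ler_peMl // ler1n -(ltr0n R).
have := step m (leqnn m); rewrite divff ?gt_eqF //.
by rewrite /q scale1r subrr scale0r addr0.
Qed.

(** * Spectral theorem for real symmetric matrices *)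

Section SpectralTheorem.
Context {R : realType} {n : nat}.
Implicit Types (S : 'M[R]_n) (w x y z : 'rV[R]_n).

(** Unless [b = 0], the expression is negative at [t = - b / (|c| + 1)]. *)
Lemma linear_coeff_eq0 (b c : R) : (forall t, 0 <= t * b + t ^+ 2 * c) -> b = 0.
Proof.
move=> H; have c1 : 0 < `|c| + 1 by rewrite ltr_wpDl.
have := H (- b / (`|c| + 1)).
rewrite [X in _ <= X](_ : _ = (b / (`|c| + 1)) ^+ 2 * (c - (`|c| + 1))); last first.
  by field; rewrite gt_eqF.
have cn : c - (`|c| + 1) < 0 by rewrite subr_lt0 (le_lt_trans (ler_norm c)) // ltrDl.
rewrite nmulr_lge0 // => b2; apply/eqP.
have : (b / (`|c| + 1)) ^+ 2 == 0 by rewrite eq_le b2 sqr_ge0.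
by rewrite sqrf_eq0 mulf_eq0 invr_eq0 (gt_eqF c1) orbF.
Qed.

(* The eigenvector maximises the Rayleigh quotient of S on the orthogonal
   complement of the rows of P. *)
Lemma exists_unit_eigenvector S k (P : 'M[R]_(k, n)) (d : 'rV[R]_k) :
  S^T = S -> (k < n)%N -> P *m S = diag_mx d *m P ->
  exists w (l : R), [/\ w *m w^T = 1%:M, w *m P^T = 0 & w *m S = l *: w].
Proof.
move=> sS kn PS.
have N1 z : z != 0 -> bform 1%:M ((Num.sqrt (bform 1%:M z z))^-1 *: z)
    ((Num.sqrt (bform 1%:M z z))^-1 *: z) = 1.
  move=> z0; rewrite bformZl bformZr mulrA -expr2 exprVn sqr_sqrtr ?bform1_ge0 //.
  by rewrite mulVf // bform1_eq0.
(* The second condition says [w *m P^T = 0], written as a scalar equation so that closedness follows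
   from continuity. *)
pose K := [set w | bform 1%:M w w = 1] `&` [set w | bform (P^T *m P) w w = 0].
have PP w : bform (P^T *m P) w w = 0 <-> w *m P^T = 0.
  have -> : bform (P^T *m P) w w = bform 1%:M (w *m P^T) (w *m P^T).
    by rewrite /bform mulmx1 trmx_mul trmxK !mulmxA.
  by split=> [/eqP|->]; [rewrite bform1_eq0 => /eqP|rewrite /bform !mul0mx mxE].
have cK T : continuous (fun w => bform T w w).
  by have := continuous_bform T 0; under eq_fun do rewrite subr0.
have compK : compact K.
  apply: bounded_closed_compact.
    have [M [Mr HM]] := @bounded_bform1 R n 0 1.
    exists M; split => // m mM x [/= x1 _]; apply: (HM m mM).
    by rewrite /= subr0 x1.
  apply: closedI.
    exact: (closed_comp (fun x _ => cK 1%:M x) (@closed_eq R 1)).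
  exact: (closed_comp (fun x _ => cK (P^T *m P) x) (@closed_eq R 0)).
have K0 : K !=set0.
  have kn0 : kermx P^T != 0.
    rewrite -mxrank_eq0 mxrank_ker mxrank_tr -lt0n subn_gt0.
    exact: leq_ltn_trans (rank_leq_row P) kn.
  have z0 : nz_row (kermx P^T) != 0 by rewrite nz_row_eq0.
  exists ((Num.sqrt (bform 1%:M (nz_row (kermx P^T)) (nz_row (kermx P^T))))^-1
            *: nz_row (kermx P^T)); split; first exact: N1.
  apply/PP; rewrite -scalemxAl (_ : _ *m _ = 0) ?scaler0 //.
  by apply/sub_kermxP; exact: nz_row_sub.
have [w /[!inE] -[/= w1 /PP wP] wmax] :=
  EVT_max_rV K0 compK (continuous_subspaceT (cK S)).
pose l := bform S w w.
have qle z : z *m P^T = 0 -> bform S z z <= l * bform 1%:M z z.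
  move=> zP; have [->|z0] := eqVneq z 0; first by rewrite /bform !mul0mx mxE mulr0.
  set s := Num.sqrt (bform 1%:M z z).
  have s0 : 0 < bform 1%:M z z by rewrite lt0r bform1_eq0 z0 bform1_ge0.
  have : bform S (s^-1 *: z) (s^-1 *: z) <= l.
    apply: wmax; rewrite inE; split; first exact: N1.
    by apply/PP; rewrite -scalemxAl zP scaler0.
  rewrite bformZl bformZr mulrA -expr2 exprVn sqr_sqrtr ?bform1_ge0 //.
  by rewrite mulrC ler_pdivrMr.
(* First variation: [w + t *: y] stays orthogonal to the rows of [P], so the maximality of [w] makes
   the linear term in [t] vanish. *)
have eigen y : y *m P^T = 0 -> bform S y w = l * bform 1%:M y w.
  move=> yP; apply/eqP; rewrite eq_sym -subr_eq0.
  suff /linear_coeff_eq0/eqP : forall t,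
      0 <= t * (2 * (l * bform 1%:M y w - bform S y w)) +
           t ^+ 2 * (l * bform 1%:M y y - bform S y y).
    by rewrite mulf_eq0 pnatr_eq0.
  move=> t.
  have := qle (w + t *: y); rewrite mulmxDl -scalemxAl wP yP scaler0 addr0.
  move=> /(_ erefl); rewrite !(bformDl, bformDr, bformZl, bformZr) w1 -/l.
  rewrite (bformC S w y sS) (bformC 1%:M w y (trmx1 _ _)) -subr_ge0.
  by congr (0 <= _); ring.
have wwE : w *m w^T = 1%:M.
  by rewrite [LHS]mx11_scalar -w1 /bform mulmx1.
exists w, l; split=> //.
(* The row space of [P] is [S]-invariant, hence so is its complement; [y] is therefore an admissible
   test vector, and testing with it gives [|y|^2 = 0]. *)
pose y := w *m S - l *: w.
have yP : y *m P^T = 0.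
  rewrite /y mulmxBl -scalemxAl wP scaler0 subr0 -mulmxA -{1}sS -trmx_mul PS.
  by rewrite trmx_mul tr_diag_mx mulmxA wP mul0mx.
suff : bform 1%:M y y == 0 by rewrite bform1_eq0 subr_eq0 => /eqP.
rewrite {2}/y bformDr -scaleNr bformZr mulNr -eigen // subr_eq0.
by rewrite /bform mulmx1 trmx_mul sS mulmxA.
Qed.

(** Induction on the number of rows, adjoining a unit eigenvector orthogonal to those already
    found. *)
Lemma exists_orthonormal_eigenvectors S k : S^T = S -> (k <= n)%N ->
  exists (P : 'M[R]_(k, n)) (d : 'rV[R]_k),
    P *m P^T = 1%:M /\ P *m S = diag_mx d *m P.
Proof.
move=> sS; elim: k => [_|k IH kn].
  exists 0, 0; split; apply/matrixP; by case.
have [P [d [PP PS]]] := IH (ltnW kn).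
have [w [l [ww wP wS]]] := exists_unit_eigenvector _ _ _ _ sS kn PS.
rewrite -add1n; exists (col_mx w P : 'M[R]_(1 + k, n)), (row_mx l%:M d : 'rV[R]_(1 + k)); split.
  rewrite tr_col_mx mul_col_row ww wP PP.
  have -> : P *m w^T = 0 by rewrite -[LHS]trmxK trmx_mul trmxK wP trmx0.
  by rewrite -scalar_mx_block.
rewrite diag_mx_row mul_block_col !mul0mx addr0 add0r mul_col_mx PS wS.
have -> : diag_mx (l%:M : 'rV[R]_1) = l%:M.
  by apply/matrixP => i j; rewrite !mxE !ord1.
by rewrite mul_scalar_mx.
Qed.

Lemma spectral_decomposition S : S^T = S ->
  exists (Q : 'M[R]_n) (d : 'I_n -> R), [/\ orthogonal_mx Q,
    \sum_i d i = \tr S &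
    forall x, bform S x x = \sum_i d i * ((x *m Q) 0 i) ^+ 2].
Proof.
move=> sS; have [P [d [PP PS]]] := exists_orthonormal_eigenvectors _ _ sS (leqnn n).
have PP' := mulmx1C PP.
have SE : S = P^T *m diag_mx d *m P by rewrite -mulmxA -PS mulmxA PP' mul1mx.
exists P^T, (d 0); split.
- by rewrite /orthogonal_mx trmxK.
- by rewrite SE mxtrace_mulC mulmxA PP mul1mx mxtrace_diag.
- move=> x; rewrite SE /bform !mulmxA -[x *m _ *m _ *m P *m _]mulmxA.
  have -> : P *m x^T = (x *m P^T)^T by rewrite trmx_mul trmxK.
  rewrite mxE; apply: eq_bigr => i _; rewrite mul_mx_diag !mxE.
  by rewrite expr2 mulrCA mulrA.
Qed.

End SpectralTheorem.

(** * The torsion function near its maximum and at the boundary *)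

Lemma bounded_closure {R : realType} {V : normedModType R} (A : set V) :
  bounded_set A -> bounded_set (closure A).
Proof.
move=> [M [_ HM]]; exists (M + 2); split; first exact: num_real.
move=> m Mm x Cx; have [y [Ay]] := Cx _ (nbhsx_ballx x 1 ltr01).
rewrite -ball_normE /ball_ /= => xy.
have yM := HM (M + 1) (ltr_pwDr ltr01 (lexx M)) y Ay.
rewrite -[x](subrK y); apply: le_trans (ler_normD _ _) _.
by rewrite /= in yM; lra.
Qed.

Lemma C2_twice_partial_on {R : realType} {n : nat} (O : set 'rV[R]_n) (u : 'rV[R]_n -> R) :
  C2_on O u ->
  twice_partial_on O u (fun i => partial i u) (fun i => partial i (partial i u)).
Proof.
by move=> [_ [d1 [_ [d2 _]]]] i x Ox; split; apply: derivableP; [exact: d1|exact: d2].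
Qed.

(** At a local minimum all pure second derivatives are nonnegative, against a Laplacian of -1. *)
Lemma torsion_no_interior_min {R : realType} {n : nat} (O : set 'rV[R]_n)
    (u : 'rV[R]_n -> R) x :
  open O -> C2_on O u -> (forall x, O x -> laplacian u x = -1) -> O x ->
  ~ (\forall y \near x, u x <= u y).
Proof.
move=> oO u2 lap Ox umin; have := lap x Ox; apply/eqP; rewrite gt_eqF //.
apply: (@lt_le_trans _ _ 0); first by rewrite ltrN10.
apply: sumr_ge0 => i _.
by have [] := second_partial_min _ _ _ _ _ (C2_twice_partial_on O u u2) (oO x Ox) umin i.
Qed.

(** The minimum over the closure can only lie on the boundary, so [u >= 0]. If [M <= 0], then [u]
    would vanish and every interior point would be a minimum. Hence [M > 0], a value not taken on
    the boundary. *)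
Lemma torsion_max_interior {R : realType} {n : nat} (O : set 'rV[R]_n)
    (u : 'rV[R]_n -> R) M :
  open O -> bounded_set O -> C2_on O u -> {within closure O, continuous u} ->
  (forall x, O x -> laplacian u x = -1) ->
  (forall x, (closure O `\` O) x -> u x = 0) ->
  is_max_on (closure O) u M ->
  0 < M /\ exists2 c, O c & u c = M.
Proof.
move=> oO bO u2 cu lap u0 [[c Cc uc] uM].
have cC : compact (closure O).
  by apply: bounded_closed_compact; [exact: bounded_closure|exact: closed_closure].
have [y /[!inE] Cy ymin] := EVT_min_rV (ex_intro _ c Cc) cC cu.
have uy : u y = 0.
  apply: u0; split=> // Oy; apply: (torsion_no_interior_min _ _ _ oO u2 lap Oy _).
  have := oO y Oy; apply: filterS => x Ox; apply: ymin; rewrite inE.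
  exact: subset_closure.
have u_ge0 x : closure O x -> 0 <= u x by move=> Cx; rewrite -uy ymin // inE.
have M0 : 0 < M.
  rewrite ltNge; apply/negP => M0.
  have [z [Oz _]] := Cc _ (filterT : nbhs c setT).
  apply: (torsion_no_interior_min _ _ _ oO u2 lap Oz _).
  have := oO z Oz; apply: filterS => x Ox.
  apply: (@le_trans _ _ 0); last exact/u_ge0/subset_closure.
  by apply: le_trans (uM z _) M0; exact: subset_closure.
split=> //; exists c => //; apply: contrapT => nOc.
by move: M0; rewrite -uc u0 ?ltxx.
Qed.

Lemma eq_on_closure {R : realType} {n : nat} (O : set 'rV[R]_n) (u g : 'rV[R]_n -> R) :
  {within closure O, continuous u} -> continuous g ->
  (forall x, O x -> u x = g x) -> forall x, closure O x -> u x = g x.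
Proof.
move=> /subspace_continuousP cu cg ug x Cx.
apply/eqP; rewrite -subr_eq0 -normr_eq0; apply/eqP.
apply/eqP; rewrite eq_le normr_ge0 andbT; apply/ler_addgt0Pr => e e0; rewrite add0r.
have e2 : 0 < e / 2 by rewrite divr_gt0.
have /cvgrPdist_lt /(_ _ e2) := cu x Cx; rewrite near_withinE => nu.
have /cvgrPdist_lt /(_ _ e2) ng := cg x.
have [y [Oy [uy gy]]] := Cx _ (filterI nu ng).
have -> : u x - g x = (u x - u y) - (g x - g y) by rewrite (ug y Oy); ring.
apply: le_trans (ler_normB _ _) _; rewrite [e]splitr.
by rewrite lerD // ltW //; exact: (uy (subset_closure Oy)).
Qed.

(** * Quadratic comparison at the maximum point *)

(** On a segment from a zero of [v], the convex function [sqrt v] grows at most linearly; squaring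
    gives the factor [t ^+ 2]. *)
Lemma convex_sqrt_growth {R : realType} {n : nat} (O : set 'rV[R]_n)
    (v : 'rV[R]_n -> R) c x (t : R) :
  convex_fun_on O (fun x => Num.sqrt (v x)) -> (forall x, O x -> 0 <= v x) ->
  convex_set_in O ->
  O c -> v c = 0 -> O x -> 0 <= t <= 1 ->
  v (t *: (x - c) + c) <= t ^+ 2 * v x.
Proof.
move=> cv v0 cO Oc vc Ox t01.
have -> : t *: (x - c) + c = t *: x + (1 - t) *: c.
  by apply/rowP => i; rewrite !mxE; ring.
have Oy := cO x c t Ox Oc t01.
have := cv x c t Ox Oc t01; rewrite vc sqrtr0 mulr0 addr0 => le_w.
have /andP[t0 _] := t01.
rewrite -(sqr_sqrtr (v0 _ Oy)) -(sqr_sqrtr (v0 _ Ox)) -exprMn.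
by rewrite ler_sqr ?nnegrE ?mulr_ge0 ?sqrtr_ge0.
Qed.

(* The slack [t^2 (M - u x) - (M - u (c + t (x - c)))] is nonnegative on [0, 1]
   and vanishes to first order at [t = 0], so its second derivative there,
   which exists since [u] is C^2, is nonnegative. *)
Lemma quadratic_lower_bound {R : realType} {n : nat} (O : set 'rV[R]_n)
    (u : 'rV[R]_n -> R) M c x :
  open O -> C2_on O u -> O c -> u c = M -> (forall x, O x -> u x <= M) ->
  (forall t : R, 0 <= t <= 1 ->
    M - u (t *: (x - c) + c) <= t ^+ 2 * (M - u x)) ->
  - (\sum_(i < n) \sum_(j < n)
      (x - c) 0 i * (x - c) 0 j * partial j (partial i u) c) <= 2 * (M - u x).
Proof.
move=> oO u2 Oc uc uM ut; have [uc0 [ud [uc1 [udd uc2]]]] := u2.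
pose y := x - c.
have [e e0 He] := line_near _ _ y (oO c Oc).
(* The first derivative test is applied to [- u], which is minimal at [c]; the constant [0 * M] only
   puts it in the form of a difference. *)
have grad0 i : partial i u c = 0.
  have d0 : twice_partial_on O (fun x => 0 * M - u x) (fun i x => 0 - partial i u x)
      (fun i x => 0 - partial i (partial i u) x).
    apply: twice_partial_onB (C2_twice_partial_on O u u2).
    by move=> j z _; split; exact: is_derive_cst.
  have [|] := second_partial_min _ _ _ _ c d0 (oO c Oc) _ i.
    by have := oO c Oc; apply: filterS => z Oz; rewrite lerB // uc uM.
  by rewrite sub0r => /eqP; rewrite oppr_eq0 => /eqP.
pose g (t : R) := t ^+ 2 * (M - u x) - (M - u (t *: y + c)).
pose g' (t : R) := 2 * t * (M - u x) + \sum_(i < n) y 0 i * partial i u (t *: y + c).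
(* Below [e] the ray stays in [O]; below 1 the growth hypothesis applies. *)
have e1 : 0 < Num.min e 1 by rewrite lt_min e0 ltr01.
have Dpoly (k t : R) : is_derive t 1 (fun s : R => s ^+ 2 * k) (2 * t * k).
  by apply: (@is_derive_quadratic R R _ t 1 _ k) => h; rewrite [h *: 1]mulr1; ring.
have : 0 <= 2 * (M - u x) + \sum_(i < n) \sum_(j < n) y 0 i * y 0 j * partial j (partial i u) c.
  apply: (@ge0_second_derive R g g' _ (Num.min e 1) e1).
  - move=> t; rewrite lt_min => /andP[te _].
    have dl : is_derive t 1 (fun s : R => u (s *: y + c))
       (\sum_(i < n) y 0 i * partial i u (t *: y + c)).
      apply: (is_derive_line u c y t _).1.
      apply: (@is_derive_continuous_partials R n u (fun i => partial i u)).
        have := oO _ (He t te); apply: filterS => z Oz i.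
        by apply: derivableP; exact: ud.
      by move=> i; apply: uc1; exact: He.
    have d1 := is_deriveB (is_derive_cst M t 1) dl.
    apply: (is_derive_eq (is_deriveB (Dpoly (M - u x) t) d1)).
    by rewrite sub0r opprK.
  - rewrite /g' mulr0 mul0r add0r scale0r add0r big1 // => i _.
    by rewrite grad0 mulr0.
  - have ds : is_derive (0 : R) 1
        (fun t : R => \sum_(i < n) y 0 i * partial i u (t *: y + c))
        (\sum_(i < n) \sum_(j < n) y 0 i * y 0 j * partial j (partial i u) c).
      have -> : (fun t : R => \sum_(i < n) y 0 i * partial i u (t *: y + c)) =
          \sum_(i < n) (fun t : R => y 0 i * partial i u (t *: y + c)).
        by apply/funext => t; rewrite fct_sumE.
      apply: is_derive_sum => i.
      have di : is_derive (0 : R) 1 (fun t : R => partial i u (t *: y + c))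
          (\sum_(j < n) y 0 j * partial j (partial i u) c).
        apply: (is_derive_line (partial i u) c y 0 _).1; rewrite scale0r add0r.
        apply: (@is_derive_continuous_partials R n _ (fun j => partial j (partial i u))).
          have := oO c Oc; apply: filterS => z Oz j.
          by apply: derivableP; exact: udd.
        by move=> j; exact: uc2.
      apply: (is_derive_eq (is_deriveZ (y 0 i) di)).
      by rewrite /GRing.scale /= mulr_sumr; apply: eq_bigr => j _; rewrite mulrA.
    apply: is_deriveD ds.
    apply: (@is_derive_quadratic R R _ 0 1 _ 0) => h.
    by rewrite [h *: 1]mulr1; ring.
  - move=> t; rewrite lt_min => /andP[t0 /andP[_ t1]].
    rewrite /g scale0r add0r uc expr0n /= mul0r subrr subr0 subr_ge0.
    by apply: ut; rewrite t0 ltW.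
by move=> ?; rewrite -subr_ge0 opprK.
Qed.

(** * Exit of rays from a convex set *)

(** [T] is the supremum of the times spent in [O]: finite as [O] is bounded, not attained as [O] is
    open. Convexity makes these times an initial interval. *)
Lemma ray_exit_time {R : realType} {n : nat} (O : set 'rV[R]_n) (c y : 'rV[R]_n) :
  open O -> bounded_set O -> convex_set_in O -> O c -> y != 0 ->
  exists T : R, [/\ 0 < T, (closure O `\` O) (T *: y + c) &
    forall t, 0 <= t -> O (t *: y + c) <-> t < T].
Proof.
move=> oO bO cO Oc y0.
pose E := [set t : R | 0 <= t /\ O (t *: y + c)].
have shiftE (s t : R) : s *: y + (t *: y + c) = (s + t) *: y + c.
  by rewrite addrA -scalerDl.
have E0 : E 0 by split => //; rewrite scale0r add0r.
have hs : has_sup E.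
  split; first by exists 0.
  have [M [_ HM]] := bO; exists ((`|M| + 1 + `|c|) / `|y|) => t [t0 Ot].
  rewrite ler_pdivlMr ?normr_gt0 // -(ger0_norm t0) -normrZ.
  rewrite -[t *: y](addrK c); apply: le_trans (ler_normB _ _) _; rewrite lerD2r.
  by apply: (HM (`|M| + 1)) => //; rewrite (le_lt_trans (ler_norm M)) // ltrDl.
have down s t : 0 <= s -> s <= t -> E t -> O (s *: y + c).
  move=> s0 st [t0 Ot]; have [t_eq0|tn0] := eqVneq t 0.
    have -> : s = 0 by apply/eqP; rewrite eq_le s0 andbT -t_eq0.
    by rewrite scale0r add0r.
  have tp : 0 < t by rewrite lt0r tn0.
  have -> : s *: y + c = (s / t) *: (t *: y + c) + (1 - s / t) *: c.
    rewrite scalerDr scalerA divfK // -addrA -scalerDl [s / t + _]addrC subrK.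
    by rewrite scale1r.
  by apply: cO => //; rewrite divr_ge0 //= ler_pdivrMr // mul1r.
have up t : E t -> exists2 s, E s & t < s.
  move=> [t0 Ot]; have [e e0 He] := line_near _ _ y (oO _ Ot).
  exists (e / 2 + t); last by rewrite ltrDr divr_gt0.
  split; first by rewrite addr_ge0 // divr_ge0 // ltW.
  rewrite -shiftE; apply: He; rewrite gtr0_norm ?divr_gt0 //.
  by rewrite ltr_pdivrMr // ltr_pMr // ltr1n.
pose T := sup E.
have ltT t : E t -> t < T.
  move=> /up[s Es ts]; apply: lt_le_trans ts _; exact: sup_upper_bound.
have T0 : 0 < T := ltT 0 E0.
exists T; split=> //.
  split; last by move=> OT; have := ltT T (conj (ltW T0) OT); rewrite ltxx.
  move=> B /(line_near _ _ y) [e e0 He].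
  have [t Et Tt] := sup_adherent e0 hs.
  exists (t *: y + c); split; first by case: Et.
  rewrite -[t](subrK T) -shiftE; apply: He.
  by rewrite ltr0_norm ?subr_lt0 ?ltT // opprB ltrBlDr -ltrBlDl.
move=> t t0; split=> [Ot|tT]; first exact: ltT.
have [s Es Ts] := sup_adherent (etrans (subr_gt0 _ _) tT) hs.
by apply: down t0 _ Es; apply: ltW; move: Ts; rewrite opprB addrC subrK.
Qed.

(** * The exact quadratic form and the ellipsoid *)

Lemma exists_quadratic_form_eq {R : realType} {n : nat} (O : set 'rV[R]_n)
    (u : 'rV[R]_n -> R) M c :
  open O -> convex_set_in O -> C2_on O u -> (forall x, O x -> laplacian u x = -1) ->
  convex_fun_on O (fun x => Num.sqrt (M - u x)) ->
  (forall x, O x -> u x <= M) -> O c -> u c = M ->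
  exists S : 'M[R]_n, [/\ S^T = S, \tr S = 2^-1 &
    forall x, O x -> u x = M - bform S (x - c) (x - c)].
Proof.
move=> oO cO u2 lap cw uM Oc uc.
have [H HE] : exists H : 'I_n -> 'I_n -> R, forall i j,
    H i j = partial j (partial i u) c by exists (fun i j => partial j (partial i u) c).
(* Symmetrising the Hessian by hand avoids Schwarz's theorem. *)
pose S : 'M[R]_n := \matrix_(i, j) (- (H i j + H j i) / 4).
have sS : S^T = S by apply/matrixP => i j; rewrite !mxE [H j i + _]addrC.
have trS : \tr S = 2^-1.
  rewrite /mxtrace; under eq_bigr => i _.
    rewrite mxE (_ : _ / 4 = - H i i / 2); last by field.
    over.
  rewrite -mulr_suml sumrN (_ : \sum_i H i i = -1) ?opprK ?mul1r //.
  by rewrite -(lap c Oc); apply: eq_bigr => i _; rewrite HE.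
(* Exchanging the summation indices shows that symmetrisation leaves the quadratic form of the
   Hessian unchanged. *)
have SE y : bform S y y = - (\sum_i \sum_j y 0 i * y 0 j * H i j) / 2.
  have E2 : \sum_i \sum_j y 0 i * y 0 j * H i j = \sum_i \sum_j y 0 i * y 0 j * H j i.
    by rewrite exchange_big; apply: eq_bigr => i _; apply: eq_bigr => j _;
      rewrite [y 0 j * _]mulrC.
  rewrite [X in X / 2](_ : _ = - (2^-1 * (\sum_i \sum_j y 0 i * y 0 j * H i j +
    \sum_i \sum_j y 0 i * y 0 j * H j i))); last by rewrite -E2; field.
  rewrite bformE -big_split mulr_sumr -sumrN mulr_suml; apply: eq_bigr => i _.
  rewrite -big_split mulr_sumr -sumrN mulr_suml; apply: eq_bigr => j _.
  by rewrite mxE /=; field.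
exists S; split=> // x Ox.
pose h x := (M - u x) - bform S (x - c) (x - c).
have dcst : twice_partial_on O (cst M) (fun _ => cst 0) (fun _ => cst 0).
  by move=> i y _; split; exact: is_derive_cst.
have dh := twice_partial_onB _ _ _ _ _ _ _ (twice_partial_onB _ _ _ _ _ _ _ dcst
  (C2_twice_partial_on O u u2)) (twice_partial_on_bform O S c sS).
suff : h x = 0 by rewrite /h => /eqP; rewrite subr_eq0 => /eqP <-; rewrite opprB addrC subrK.
(* [h] has Laplacian [1 - 2 * \tr S = 0], is nonnegative by the quadratic bound, and vanishes at
   [c]. *)
apply: (@superharmonic_strong_min R n O h _ _ c x oO cO dh) => //.
- move=> y Oy; rewrite !sumrB -mulr_sumr -/(mxtrace S) trS divff // /cst /=.
  by rewrite big1 // sub0r -/(laplacian u y) (lap y Oy) opprK subrr.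
- move=> y Oy; have cu := u2.1 y Oy.
  exact: (cvgB (cvgB (cvg_cst M) cu) (@continuous_bform R n S c y)).
- move=> y Oy; rewrite subr_ge0 SE ler_pdivrMr // mulrC.
  under eq_bigr do under eq_bigr do rewrite HE.
  apply: (@quadratic_lower_bound R n O) => // t t01.
  apply: (@convex_sqrt_growth R n O (fun x => M - u x)) => //.
    by move=> z Oz; rewrite subr_ge0 uM.
  by rewrite uc subrr.
- by rewrite /h uc !subrr {1}/bform !mul0mx mxE subrr.
Qed.

Theorem theorem1p4 (R : realType) (n : nat) (Omega : set 'rV[R]_n)
  (u : 'rV[R]_n -> R) :
  (2 <= n)%N ->
  open Omega -> bounded_set Omega ->
  C2_on Omega u ->
  {within closure Omega, continuous u} ->
  (forall x, Omega x -> laplacian u x = -1) ->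
  (forall x, (closure Omega `\` Omega) x -> u x = 0) ->
  property_A Omega u ->
  exists (Q : 'M[R]_n) (c : 'rV[R]_n) (a : 'I_n -> R) (r : R),
    [/\ orthogonal_mx Q, 0 < r,
        (forall i, 0 < a i) /\ \sum_(i < n) a i = n%:R,
        Omega = [set x | ell_form Q a c x < r ^+ 2] &
        forall x, closure Omega x ->
          u x = (r ^+ 2 - ell_form Q a c x) / (2 * n%:R)].
Proof.
move=> n2 oO bO u2 cu lap u0 [cO [M [umax cw]]].
have [M0 [c Oc uc]] := torsion_max_interior _ _ _ oO bO u2 cu lap u0 umax.
have uM x : Omega x -> u x <= M by move=> Ox; apply: umax.2; exact: subset_closure.
have [S [sS trS uE]] := exists_quadratic_form_eq _ _ _ _ oO cO u2 lap cw uM Oc uc.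
have {}uE x : closure Omega x -> u x = M - bform S (x - c) (x - c).
  apply: (eq_on_closure _ _ (fun x => M - bform S (x - c) (x - c)) cu) => // y.
  exact: (cvgB (cvg_cst M) (@continuous_bform R n S c y)).
(* The formula for [u] on the closure is evaluated at the exit point, where [u = 0]. *)
have ray y : y != 0 -> exists T, [/\ 0 < T, T ^+ 2 * bform S y y = M &
    forall t, 0 <= t -> Omega (t *: y + c) <-> t < T].
  move=> y0; have [T [T0 CT HT]] := ray_exit_time _ c y oO bO cO Oc y0.
  exists T; split=> //; have := uE _ CT.1.
  rewrite u0 // addrK bformZl bformZr mulrA -expr2 => /esym/eqP.
  by rewrite subr_eq0 => /eqP.
have Spos y : y != 0 -> 0 < bform S y y.
  by move=> /ray[T [T0 TM _]]; move: M0; rewrite -TM pmulr_rgt0 // exprn_gt0.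
(* The point [x] is reached at time 1 on the ray along [x - c], so it lies in [Omega] iff [1 < T],
   that is, iff the form at [x - c] is below [T ^+ 2] times itself, which is [M]. *)
have OE x : Omega x <-> bform S (x - c) (x - c) < M.
  have [->|xc] := eqVneq x c; first by rewrite subrr {1}/bform !mul0mx mxE.
  have y0 : x - c != 0 by rewrite subr_eq0.
  have [T [T0 TM HT]] := ray _ y0; have := HT 1 ler01; rewrite scale1r subrK => ->.
  rewrite -TM -[X in _ <-> X < _]mul1r ltr_pM2r ?Spos // -[in X in _ <-> X](expr1n R 2).
  by rewrite ltr_sqr ?nnegrE // ltW.
have [Q [d [oQ sd SE]]] := spectral_decomposition S sS.
have n0 : 0 < n%:R :> R by rewrite ltr0n (leq_trans _ n2).
have ellE x : ell_form Q (fun i => 2 * n%:R * d i) c x = 2 * n%:R * bform S (x - c) (x - c).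
  by rewrite /ell_form SE mulr_sumr; apply: eq_bigr => i _; rewrite mulrA.
have rE : Num.sqrt (2 * n%:R * M) ^+ 2 = 2 * n%:R * M.
  by rewrite sqr_sqrtr // !mulr_ge0 // ltW.
have nn0 : 0 < 2 * n%:R :> R by rewrite mulr_gt0.
(* Scaling by [2 * n] turns the trace [1/2] into [n] and the level [M] into [r ^+ 2]. *)
exists Q, c, (fun i => 2 * n%:R * d i), (Num.sqrt (2 * n%:R * M)); split=> //.
- by rewrite sqrtr_gt0 mulr_gt0.
- split=> [i|]; last by rewrite -mulr_sumr sd trS mulrAC divff ?mul1r.
  rewrite mulr_gt0 //.
  have QQ : Q^T *m Q = 1%:M by exact: mulmx1C.
  (* This vector has the [i]-th basis vector as its coordinates after applying [Q], so the form
     takes the value [d i] on it. *)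
  have yQ : basis_vec R i *m Q^T *m Q = basis_vec R i by rewrite -mulmxA QQ mulmx1.
  have y0 : basis_vec R i *m Q^T != 0.
    apply/eqP => y0; move: yQ; rewrite y0 mul0mx => /rowP/(_ i)/eqP.
    by rewrite !mxE !eqxx eq_sym oner_eq0.
  have := Spos _ y0; rewrite SE yQ (bigD1 i) //= big1 ?addr0 => [|j /negPf ji].
    by rewrite mxE !eqxx expr1n mulr1.
  by rewrite mxE ji andbF expr0n mulr0.
- by apply/seteqP; split=> x; rewrite /= ellE rE ltr_pM2l // => /OE.
- move=> x Cx; rewrite ellE rE -mulrBr mulrAC divff ?mul1r ?gt_eqF //; exact: uE.
Qed.
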